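(* For every extended multiset $\langle X,\sigma\rangle$ define $\eta_X:X\to\mathcal{H}_c(A_{X,\sigma})$ by $\eta_X(x)(f)=f(x)$. Then $\mathcal{H}\circ\mathcal{F}$ is naturally equivalent to the identity functor of $\mathbb{EM}$ via $\eta$: for all extended multisets $\langle X,\sigma\rangle,\langle Y,\mu\rangle$ and every morphism $\varphi:\langle X,\sigma\rangle\to\langle Y,\mu\rangle$ in $\mathbb{EM}$, one has $\mathcal{H}(\mathcal{F}(\varphi))(\eta_X(x))=\eta_Y(\varphi(x))$ for every $x\in X$, i.e. $\eta_X(x)\circ\mathcal{F}(\varphi)=\eta_Y(\varphi(x))$.
   Context: Let $\mathbb{N}=\{1,2,\dots\}$, $\overline{\mathbb{N}}=\mathbb{N}\cup\{\infty\}$. For $n\geq2$ an integer, $Ł_n=[0,1]\cap\frac{1}{n-1}\mathbb{Z}$ is a subalgebra of the standard MV-algebra $[0,1]$ ($x\oplus y=\min\{x+y,1\}$, $\neg x=1-x$), and $Ł_\infty=[0,1]$. An extended multiset is a pair $\langle X,\sigma\rangle$ with $X$ a set and $\sigma:X\to\overline{\mathbb{N}}$; a morphism $\langle X,\sigma\rangle\to\langle Y,\mu\rangle$ in the category $\mathbb{EM}$ is a map $\varphi:X\to Y$ such that whenever $\sigma(x)$ is finite, $\mu(\varphi(x))$ is finite and divides $\sigma(x)$. A compact Hausdorff MV-algebra (CHMV-algebra) is an MV-algebra with a compact Hausdorff topology making $\oplus,\neg$ continuous; $\mathbb{CHMV}$ is the category of these with continuous homomorphisms. For a CHMV-algebra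 $A$, $\mathcal{H}_c(A)$ is the set of MV-homomorphisms $\chi:A\to[0,1]$ whose kernel $\{a:\chi(a)=0\}$ is compact, and $\sigma_A(\chi)=\#\chi(A)-1\in\overline{\mathbb{N}}$ (equal to $\infty$ if $\chi(A)$ is infinite); $\mathcal{H}(A)=\langle\mathcal{H}_c(A),\sigma_A\rangle$, and for a continuous homomorphism $\psi:B\to A$, $\mathcal{H}(\psi):\mathcal{H}_c(A)\to\mathcal{H}_c(B)$, $\chi\mapsto\chi\circ\psi$. For an extended multiset, $\mathcal{F}(\langle X,\sigma\rangle)=A_{X,\sigma}=\prod_{x\in X}Ł_{\sigma(x)+1}$ (product topology), and for a morphism $\varphi:\langle X,\sigma\rangle\to\langle Y,\mu\rangle$, $\mathcal{F}(\varphi):A_{Y,\mu}\to A_{X,\sigma}$, $\mathcal{F}(\varphi)(f)(x)=f(\varphi(x))$. These give functors $\mathcal{H}:\mathbb{CHMV}^{op}\to\mathbb{EM}$ and $\mathcal{F}:\mathbb{EM}\to\mathbb{CHMV}^{op}$. *)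

(* Defs.v *)
(* The unit interval is that of an arbitrary [R : realType]; sets are types.  *)
From HB Require Import structures.
From mathcomp Require Import all_boot all_order all_algebra finmap.
From mathcomp Require Import all_classical all_reals all_analysis.
From mathcomp Require Import lra.

Set Implicit Arguments.
Unset Strict Implicit.
Unset Printing Implicit Defensive.

Import Order.TTheory GRing.Theory Num.Theory.
Import numFieldNormedType.Exports.

Local Open Scope classical_set_scope.
Local Open Scope ring_scope.

Record category := Category {
  obj :> Type;
  hom : obj -> obj -> Type;
  idm : forall a, hom a a;
  compm : forall a b c, hom b c -> hom a b -> hom a c;
  comp1m : forall a b (f : hom a b), compm (idm b) f = f;
  compm1 : forall a b (f : hom a b), compm f (idm a) = f;
  compmA : forall a b c d (h : hom c d) (g : hom b c) (f : hom a b),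
    compm h (compm g f) = compm (compm h g) f }.

Arguments hom {_} _ _.
Arguments idm {_} _.
Arguments compm {_ a b c} _ _.

Definition opposite (C : category) : category :=
  @Category C (fun a b => @hom C b a) (@idm C) (fun a b c g f => compm f g)
    (fun a b f => compm1 f) (fun a b f => comp1m f)
    (fun a b c d h g f => esym (compmA f g h)).

Definition is_isomorphism (C : category) (a b : C) (f : hom a b) :=
  exists g : hom b a, compm g f = idm a /\ compm f g = idm b.

Record functor (C D : category) := Functor {
  fobj :> C -> D;
  fmap : forall a b : C, hom a b -> hom (fobj a) (fobj b);
  fmap1 : forall a, fmap (idm a) = idm (fobj a);
  fmapM : forall a b c (g : hom b c) (f : hom a b),
    fmap (compm g f) = compm (fmap g) (fmap f) }.

Definition functor_id (C : category) : functor C C :=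
  @Functor C C id (fun a b f => f) (fun a => erefl) (fun a b c g f => erefl).

Section FunctorComp.
Variables (C D E : category) (G : functor D E) (F : functor C D).

Let fcmap (a b : C) (f : hom a b) : hom (G (F a)) (G (F b)) :=
  fmap G (fmap F f).

Let fcmap1 a : fcmap (idm a) = idm (G (F a)).
Proof. by rewrite /fcmap !fmap1. Qed.

Let fcmapM a b c (g : hom b c) (f : hom a b) :
  fcmap (compm g f) = compm (fcmap g) (fcmap f).
Proof. by rewrite /fcmap !fmapM. Qed.

Definition functor_comp : functor C E :=
  @Functor C E (fun a => G (F a)) fcmap fcmap1 fcmapM.

End FunctorComp.

Record nat_trans (C D : category) (F G : functor C D) := NatTrans {
  component :> forall a : C, hom (F a) (G a);
  naturality : forall (a b : C) (f : hom a b),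
    compm (fmap G f) (component a) = compm (component b) (fmap F f) }.

Definition is_natural_equivalence (C D : category) (F G : functor C D)
    (alpha : nat_trans F G) :=
  forall a : C, is_isomorphism (alpha a).

(* The positive integers together with infinity, which is [None]. *)
Record natbar := NatBar {
  natbar_val :> option nat;
  natbar_neq0 : natbar_val != Some 0%N }.

HB.instance Definition _ := [isSub for natbar_val].
HB.instance Definition _ := [Equality of natbar by <:].

Record ext_multiset := ExtMultiset {
  em_sort :> Type;
  mult : em_sort -> natbar }.

Definition fin_dvd (m s : natbar) :=
  forall n, s = Some n :> option nat ->
  exists2 k, m = Some k :> option nat & (k %| n)%N.

Record em_hom (X Y : ext_multiset) := EMHom {
  em_fun :> X -> Y;
  em_funP : forall x, fin_dvd (mult (em_fun x)) (mult x) }.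

Arguments em_funP {X Y} _ _ _ _.

Lemma em_hom_eq X Y (f g : em_hom X Y) : f =1 g -> f = g.
Proof.
case: f g => [f fP] [g gP] /= /funext fg; rewrite {}fg in fP *.
by congr EMHom; exact: Prop_irrelevance.
Qed.

Section EMCategory.

Lemma fin_dvd_refl (s : natbar) : fin_dvd s s.
Proof. by move=> n ->; exists n. Qed.

Lemma fin_dvd_trans (a b c : natbar) : fin_dvd a b -> fin_dvd b c -> fin_dvd a c.
Proof.
move=> ab bc n /bc[k /ab[l -> lk] kn]; exists l => //; exact: dvdn_trans kn.
Qed.

Definition em_id (X : ext_multiset) : em_hom X X :=
  @EMHom X X id (fun x => @fin_dvd_refl (mult x)).

Definition em_comp (X Y Z : ext_multiset) (g : em_hom Y Z) (f : em_hom X Y) :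
    em_hom X Z :=
  @EMHom X Z (g \o f) (fun x => fin_dvd_trans (em_funP g (f x)) (em_funP f x)).

Let em_comp1m X Y (f : em_hom X Y) : em_comp (em_id Y) f = f.
Proof. exact: em_hom_eq. Qed.

Let em_compm1 X Y (f : em_hom X Y) : em_comp f (em_id X) = f.
Proof. exact: em_hom_eq. Qed.

Let em_compA X Y Z T (h : em_hom Z T) (g : em_hom Y Z) (f : em_hom X Y) :
  em_comp h (em_comp g f) = em_comp (em_comp h g) f.
Proof. exact: em_hom_eq. Qed.

Definition EMcat : category :=
  @Category ext_multiset em_hom em_id em_comp em_comp1m em_compm1 em_compA.

End EMCategory.

HB.mixin Record isMV T := {
  mv0 : T;
  mvneg : T -> T;
  mvadd : T -> T -> T;
  mvaddA : associative mvadd;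
  mvaddC : commutative mvadd;
  mvadd0 : right_id mv0 mvadd;
  mvnegK : involutive mvneg;
  mvadd1 : right_zero (mvneg mv0) mvadd;
  mvaddnn : forall x y,
    mvadd (mvneg (mvadd (mvneg x) y)) y = mvadd (mvneg (mvadd (mvneg y) x)) x }.

#[short(type="mvType")]
HB.structure Definition MV := { T of isMV T }.

Record mv_hom (A B : mvType) := MVHom {
  mv_fun :> A -> B;
  mv_hom0 : mv_fun mv0 = mv0;
  mv_homN : {morph mv_fun : x / mvneg x};
  mv_homD : {morph mv_fun : x y / mvadd x y} }.

Lemma mv_hom_eq A B (f g : mv_hom A B) : f =1 g -> f = g.
Proof.
case: f g => [f f0 fN fD] [g g0 gN gD] /= /funext fg; rewrite {}fg in f0 fN fD *.
by congr MVHom; exact: Prop_irrelevance.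
Qed.

Definition mv_id (A : mvType) : mv_hom A A :=
  @MVHom A A id erefl (fun x => erefl) (fun x y => erefl).

Section MVComp.
Variables (A B C : mvType) (g : mv_hom B C) (f : mv_hom A B).

Let comp0 : (g \o f) mv0 = mv0.
Proof. by rewrite /= !mv_hom0. Qed.

Let compN : {morph (g \o f) : x / mvneg x}.
Proof. by move=> x; rewrite /= !mv_homN. Qed.

Let compD : {morph (g \o f) : x y / mvadd x y}.
Proof. by move=> x y; rewrite /= !mv_homD. Qed.

Definition mv_comp : mv_hom A C := MVHom comp0 compN compD.

End MVComp.

HB.mixin Record isCompactHausdorffMV T of MV T & Topological T := {
  chmv_compact : compact [set: T];
  chmv_hausdorff : hausdorff_space T;
  chmv_negC : continuous (@mvneg T);
  chmv_addC : continuous (fun p : T * T => mvadd p.1 p.2) }.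

#[short(type="chmvType")]
HB.structure Definition CHMV :=
  { T of isCompactHausdorffMV T & MV T & Topological T }.

Record chmv_hom (A B : chmvType) := CHMVHom {
  chmv_fun :> mv_hom A B;
  chmv_cont : continuous chmv_fun }.

Lemma chmv_hom_eq (A B : chmvType) (f g : chmv_hom A B) : f =1 g -> f = g.
Proof.
case: f g => [f fC] [g gC] /= /mv_hom_eq fg; rewrite {}fg in fC *.
by congr CHMVHom; exact: Prop_irrelevance.
Qed.

Section CHMVCategory.

Let id_cont (A : chmvType) : continuous (mv_id A).
Proof. by move=> x; exact: cvg_id. Qed.

Definition chmv_id (A : chmvType) : chmv_hom A A := CHMVHom (@id_cont A).

Let comp_cont (A B C : chmvType) (g : chmv_hom B C) (f : chmv_hom A B) :
  continuous (mv_comp g f).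
Proof. by move=> x; apply: continuous_comp; exact: chmv_cont. Qed.

Definition chmv_comp (A B C : chmvType) (g : chmv_hom B C) (f : chmv_hom A B) :
  chmv_hom A C := CHMVHom (@comp_cont A B C g f).

Let chmv_comp1m (A B : chmvType) (f : chmv_hom A B) :
  chmv_comp (chmv_id B) f = f.
Proof. exact: chmv_hom_eq. Qed.

Let chmv_compm1 (A B : chmvType) (f : chmv_hom A B) :
  chmv_comp f (chmv_id A) = f.
Proof. exact: chmv_hom_eq. Qed.

Let chmv_compA (A B C D : chmvType) (h : chmv_hom C D) (g : chmv_hom B C)
    (f : chmv_hom A B) :
  chmv_comp h (chmv_comp g f) = chmv_comp (chmv_comp h g) f.
Proof. exact: chmv_hom_eq. Qed.

Definition CHMVcat : category := @Category chmvType chmv_hom chmv_id chmv_comp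
  chmv_comp1m chmv_compm1 chmv_compA.

End CHMVCategory.

(* The universe of the chain L_(s+1): the index is shifted by one, so that    *)
(* the factor of A_(X,sigma) at x is [luk_set R (mult x)].                    *)
Definition luk_set (R : realType) (s : natbar) : set R :=
  if natbar_val s is Some n
  then `[0, 1] `&` [set z%:~R / n%:R | z in [set: int]]
  else `[0, 1]%classic.

Arguments luk_set : clear implicits.

Definition luk (R : realType) (s : natbar) := set_type (luk_set R s).

HB.instance Definition _ R s := Topological.on (luk R s).

Section LukMV.
Variables (R : realType) (s : natbar).
Local Notation L := (luk R s).

Lemma luk_set01 (x : R) : luk_set R s x -> 0 <= x <= 1.
Proof. by rewrite /luk_set; case: (natbar_val s) => [n [] |]; rewrite /= in_itv. Qed.

Lemma luk01 (x : L) : 0 <= \val x <= 1.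
Proof. by apply: luk_set01; exact: set_mem (valP x). Qed.

Lemma luk_set0 : luk_set R s 0.
Proof.
rewrite /luk_set; case: (natbar_val s) => [n|]; last by rewrite /= in_itv/= lexx ler01.
by split; [rewrite /= in_itv/= lexx ler01|exists 0 => //; rewrite mul0r].
Qed.

Lemma luk_set_neg (x : R) : luk_set R s x -> luk_set R s (1 - x).
Proof.
rewrite /luk_set; case: s => -[n|] /= n0; rewrite /= !in_itv/=; last first.
  by move=> ?; lra.
move=> [? [z _ zx]]; split; first lra.
exists (n%:Z - z) => //; rewrite rmorphB/= mulrBl zx divff//.
by rewrite pnatr_eq0; apply: contraNneq n0 => ->.
Qed.

Lemma luk_set_add (x y : R) :
  luk_set R s x -> luk_set R s y -> luk_set R s (Num.min (x + y) 1).
Proof.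
have l1 : luk_set R s 1 by rewrite -[1]subr0; exact/luk_set_neg/luk_set0.
case: (leP (x + y) 1) => // xy1; move: l1.
rewrite /luk_set; case: (natbar_val s) => [n|]; rewrite /= !in_itv/=; last first.
  by move=> *; lra.
move=> _ [? [z _ zx]] [? [w _ wy]]; split; first lra.
by exists (z + w) => //; rewrite rmorphD/= mulrDl zx wy.
Qed.

Definition luk_zero : L := exist _ 0 (mem_set luk_set0).

Definition luk_neg (x : L) : L :=
  exist _ (1 - \val x) (mem_set (luk_set_neg (set_mem (valP x)))).

Definition luk_add (x y : L) : L :=
  exist _ (Num.min (\val x + \val y) 1)
    (mem_set (luk_set_add (set_mem (valP x)) (set_mem (valP y)))).

Ltac case_min := rewrite /=; repeat match goal with
  | |- context [Num.min ?a ?b] => case: (leP a b)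
  end; move=> *; lra.

Let luk_addA : associative luk_add.
Proof.
move=> x y z; apply: val_inj => /=.
have := luk01 x; have := luk01 y; have := luk01 z; case_min.
Qed.

Let luk_addC : commutative luk_add.
Proof. by move=> x y; apply: val_inj => /=; rewrite addrC. Qed.

Let luk_add0 : right_id luk_zero luk_add.
Proof. by move=> x; apply: val_inj => /=; have := luk01 x; case_min. Qed.

Let luk_negK : involutive luk_neg.
Proof. by move=> x; apply: val_inj => /=; lra. Qed.

Let luk_add1 : right_zero (luk_neg luk_zero) luk_add.
Proof. by move=> x; apply: val_inj => /=; have := luk01 x; case_min. Qed.

Let luk_addnn x y :
  luk_add (luk_neg (luk_add (luk_neg x) y)) y =
  luk_add (luk_neg (luk_add (luk_neg y) x)) x.
Proof.
apply: val_inj => /=; have := luk01 x; have := luk01 y; case_min.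
Qed.

HB.instance Definition _ := isMV.Build L
  luk_addA luk_addC luk_add0 luk_negK luk_add1 luk_addnn.

End LukMV.

Section LukCHMV.
Variables (R : realType) (s : natbar).
Local Notation L := (luk R s).

Let val_cont : continuous (val : L -> R).
Proof. exact: (@initial_continuous L R set_val). Qed.

Let luk_set_compact : compact (luk_set R s).
Proof.
rewrite /luk_set; case: s => -[n|] /= n0; last exact: segment_compact.
have n_gt0 : (0 < n%:R :> R).
  by rewrite ltr0n lt0n; apply: contraNneq n0 => ->.
apply: finite_compact.
apply: (@sub_finite_set _ _ ((fun k : nat => k%:R / n%:R) @` `I_n.+1)).
  move=> x [/=]; rewrite in_itv/= => /andP[x0 x1] [z _ zx].
  move: x0 x1; rewrite -zx pmulr_lge0 ?invr_gt0// ler_pdivrMr// mul1r ler0z.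
  case: z {zx} => [k|//] _; rewrite -pmulrn ler_nat => kn.
  by exists k => //=; rewrite ltnS.
exact/finite_image/finite_II.
Qed.

Lemma luk_compact : compact [set: L].
Proof.
move=> F FF _.
have FA : (val @ F) (luk_set R s).
  rewrite /fmap/=; apply: filterS (filterT : F setT) => x _ /=.
  exact: set_mem (valP x).
have [p [Ap clp]] := luk_set_compact (fmap_proper_filter _ FF) FA.
exists (exist _ p (mem_set Ap)); split => // A B FA' [U [/= [W oW <-] Wp WB]].
have FvA : (val @ F) (val @` A).
  by rewrite /fmap/=; apply: filterS FA' => x Ax; exists x.
have [_ [[x Ax <-] Wx]] := clp (val @` A) W FvA (open_nbhs_nbhs (conj oW Wp)).
by exists x; split => //; exact: WB.
Qed.

Lemma luk_hausdorff : hausdorff_space L.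
Proof.
move=> p q clpq; apply: val_inj; apply: (@Rhausdorff R) => A B Ap Bq.
have [x [? ?]] := clpq _ _ (val_cont Ap) (val_cont Bq).
by exists (val x).
Qed.

Lemma luk_negC : continuous (@mvneg L).
Proof.
apply: (@continuous_comp_initial _ _ _ (@set_val R (luk_set R s))) => x.
apply: (@continuousB R R^o L (cst 1) val x); first exact: cst_continuous.
exact: val_cont.
Qed.

Lemma luk_addC : continuous (fun p : L * L => mvadd p.1 p.2).
Proof.
apply: (@continuous_comp_initial _ _ _ (@set_val R (luk_set R s))) => -[x y].
apply: (@continuous_min R (L * L)%type (fun p => val p.1 + val p.2) (cst 1));
  last exact: cst_continuous.
apply: (@continuousD R R^o (L * L)%type (val \o fst) (val \o snd)) => /=.
  by apply: (@cvg_comp _ _ _ fst val); [exact: cvg_fst|exact: val_cont].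
by apply: (@cvg_comp _ _ _ snd val); [exact: cvg_snd|exact: val_cont].
Qed.

HB.instance Definition _ :=
  isCompactHausdorffMV.Build L luk_compact luk_hausdorff luk_negC luk_addC.

End LukCHMV.

Section ProdTopology.
Context {I : Type} {K : I -> topologicalType}.

Lemma prod_eval_continuous (i : I) :
  continuous (fun f : prod_topology K => f i).
Proof.
move=> f; have /cvg_sup/(_ i) fi : nbhs f --> (f : prod_topology K) by [].
move=> A Ai; apply: fi.
exact: (@initial_continuous _ (K i) (fun g : prod_topology K => g i) f A Ai).
Qed.

Lemma continuous_prod_topology (T : topologicalType) (g : T -> prod_topology K) :
  (forall i, continuous (fun t => g t i)) -> continuous g.
Proof.
move=> gC t; apply/cvg_sup => i A.
exact: (@continuous_comp_initial _ _ _ (fun f : prod_topology K => f i)).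
Qed.

End ProdTopology.

Definition luk_prod (R : realType) (X : ext_multiset) :=
  prod_topology (fun x : X => luk R (mult x)).

HB.instance Definition _ R X := Topological.copy (luk_prod R X)
  (prod_topology (fun x : em_sort X => luk R (mult x))).

Section LukProd.
Variables (R : realType) (X : ext_multiset).
Local Notation A := (luk_prod R X).

Definition prod_zero : A := fun=> mv0.
Definition prod_neg (f : A) : A := fun x => mvneg (f x).
Definition prod_add (f g : A) : A := fun x => mvadd (f x) (g x).

Let prod_addA : associative prod_add.
Proof. by move=> f g h; apply: functional_extensionality_dep => x; exact: mvaddA. Qed.

Let prod_addC : commutative prod_add.
Proof. by move=> f g; apply: functional_extensionality_dep => x; exact: mvaddC. Qed.

Let prod_add0 : right_id prod_zero prod_add.
Proof. by move=> f; apply: functional_extensionality_dep => x; exact: mvadd0. Qed.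

Let prod_negK : involutive prod_neg.
Proof. by move=> f; apply: functional_extensionality_dep => x; exact: mvnegK. Qed.

Let prod_add1 : right_zero (prod_neg prod_zero) prod_add.
Proof. by move=> f; apply: functional_extensionality_dep => x; exact: mvadd1. Qed.

Let prod_addnn f g : prod_add (prod_neg (prod_add (prod_neg f) g)) g =
  prod_add (prod_neg (prod_add (prod_neg g) f)) f.
Proof. by apply: functional_extensionality_dep => x; exact: mvaddnn. Qed.

Lemma luk_prod_eval_continuous (x : X) : continuous (fun f : A => f x).
Proof.
exact: (@prod_eval_continuous X (fun x : X => luk R (mult x)) x).
Qed.

HB.instance Definition _ := isMV.Build A
  prod_addA prod_addC prod_add0 prod_negK prod_add1 prod_addnn.

Let prod_compact : compact [set: A].
Proof.
have := @tychonoff {classic X} (fun x : X => luk R (mult x)) (fun=> setT)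
  (fun=> @luk_compact _ _).
by congr (compact _); apply/seteqP; split.
Qed.

Let prod_hausdorff : hausdorff_space A.
Proof.
exact: (@hausdorff_product {classic X} (fun x : X => luk R (mult x))
  (fun=> @luk_hausdorff _ _)).
Qed.

Let prod_negC : continuous (@mvneg A).
Proof.
apply: continuous_prod_topology => x f.
apply: (@cvg_comp _ _ _ (fun g : A => g x) mvneg).
  exact: luk_prod_eval_continuous.
exact: chmv_negC.
Qed.

Let prod_addC' : continuous (fun p : A * A => mvadd p.1 p.2).
Proof.
apply: continuous_prod_topology => x -[f g].
apply: (@cvg_comp _ _ _ (fun p : A * A => (p.1 x, p.2 x))
  (fun p => mvadd p.1 p.2)); last exact: (@chmv_addC (luk R (mult x)) (f x, g x)).
apply: (@cvg_pair _ _ _ (nbhs (f, g)) (nbhs (f x)) (nbhs (g x))) => /=.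
  apply: (@cvg_comp _ _ _ fst (fun g : A => g x)); first exact: cvg_fst.
  exact: luk_prod_eval_continuous.
apply: (@cvg_comp _ _ _ snd (fun g : A => g x)); first exact: cvg_snd.
exact: luk_prod_eval_continuous.
Qed.

HB.instance Definition _ := isCompactHausdorffMV.Build A
  prod_compact prod_hausdorff prod_negC prod_addC'.

End LukProd.

Section FunctorF.
Variable R : realType.

Lemma luk_set_sub (m s : natbar) : fin_dvd m s -> luk_set R m `<=` luk_set R s.
Proof.
rewrite /luk_set /fin_dvd; case: s => -[n|] /= n0; last first.
  by move=> _; case: (natbar_val m) => [k|] // x [].
move=> /(_ n erefl)[k -> /dvdnP[d nE]] x [x01 [z _ zx]]; split => //.
have n_neq0 : (n%:R != 0 :> R).
  by rewrite pnatr_eq0; apply: contraNneq n0 => ->.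
exists (z * d%:Z) => //; rewrite -zx nE natrM rmorphM/= -pmulrn.
have d0 : (d%:R != 0 :> R) by apply: contraNneq n_neq0; rewrite nE natrM => ->; rewrite mul0r.
by rewrite [d%:R * _]mulrC -mulf_div divff// mulr1.
Qed.

Definition luk_incl (m s : natbar) (ms : fin_dvd m s) (a : luk R m) : luk R s :=
  exist _ (\val a) (mem_set (luk_set_sub ms (set_mem (valP a)))).

Lemma luk_incl_continuous m s (ms : fin_dvd m s) : continuous (luk_incl ms).
Proof.
apply: (@continuous_comp_initial _ _ _ (@set_val R (luk_set R s))).
exact: (@initial_continuous (luk R m) R set_val).
Qed.

Section Map.
Variables (X Y : ext_multiset) (phi : em_hom X Y).

Definition F_fun (f : luk_prod R Y) : luk_prod R X :=
  fun x => luk_incl (em_funP phi x) (f (phi x)).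

Let F_fun0 : F_fun mv0 = mv0.
Proof. by apply: functional_extensionality_dep => x; exact: val_inj. Qed.

Let F_funN : {morph F_fun : f / mvneg f}.
Proof. by move=> f; apply: functional_extensionality_dep => x; exact: val_inj. Qed.

Let F_funD : {morph F_fun : f g / mvadd f g}.
Proof. by move=> f g; apply: functional_extensionality_dep => x; exact: val_inj. Qed.

Let F_fun_cont : continuous (MVHom F_fun0 F_funN F_funD).
Proof.
apply: continuous_prod_topology => x f.
apply: (@cvg_comp _ _ _ (fun g : luk_prod R Y => g (phi x))
  (luk_incl (em_funP phi x))); first exact: luk_prod_eval_continuous.
exact: luk_incl_continuous.
Qed.

Definition F_map : chmv_hom (luk_prod R Y) (luk_prod R X) := CHMVHom F_fun_cont.

End Map.

Let F_map1 X : F_map (em_id X) = chmv_id (luk_prod R X).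
Proof.
by apply: chmv_hom_eq => f; apply: functional_extensionality_dep => x; exact: val_inj.
Qed.

Let F_mapM X Y Z (g : em_hom Y Z) (f : em_hom X Y) :
  F_map (em_comp g f) = chmv_comp (F_map f) (F_map g).
Proof.
by apply: chmv_hom_eq => h; apply: functional_extensionality_dep => x; exact: val_inj.
Qed.

Definition F_functor : functor EMcat (opposite CHMVcat) :=
  @Functor EMcat (opposite CHMVcat) (luk_prod R) F_map F_map1 F_mapM.

End FunctorF.

Definition natbar_infty : natbar := @NatBar None erefl.

Notation unitI R := (luk R natbar_infty).

(* [compact_char R A] is the set H_c(A). *)
Record compact_char (R : realType) (A : chmvType) := CompactChar {
  char_hom :> mv_hom A (unitI R);
  char_compact : compact [set a | char_hom a = mv0] }.

Lemma compact_char_eq R A (chi xi : compact_char R A) : chi =1 xi -> chi = xi.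
Proof.
case: chi xi => [chi chiC] [xi xiC] /= /mv_hom_eq eq; rewrite {}eq in chiC *.
by congr CompactChar; exact: Prop_irrelevance.
Qed.

Section FiniteSubalgebra.
Variable R : realType.
Local Notation I := (unitI R).

Let mv_closed (S : set I) := [/\ S mv0, forall x, S x -> S (mvneg x) &
  forall x y, S x -> S y -> S (mvadd x y)].

Let seq_min (s : seq R) : s != [::] ->
  exists2 d, d \in s & forall x, x \in s -> d <= x.
Proof.
elim: s => // a s IH _; case: (eqVneq s [::]) => [->|/IH[d ds dmin]].
  by exists a; rewrite ?mem_head// => x; rewrite inE => /eqP ->.
case: (leP a d) => ad.
  exists a; rewrite ?mem_head// => x; rewrite inE => /predU1P[->//|/dmin].
  exact: le_trans.
exists d; first by rewrite inE ds orbT.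
by move=> x; rewrite inE => /predU1P[->|/dmin//]; exact: ltW.
Qed.

(* A finite subalgebra of [0,1] consists of the multiples of 1/m, for some    *)
(* positive m.                                                                *)
Let fin_subalg (S : set I) : finite_set S -> mv_closed S ->
  exists2 m, (0 < m)%N & val @` S = [set k%:R / m%:R | k in `I_m.+1].
Proof.
move=> finS [S0 SN SD]; set T := val @` S.
have T01 x : T x -> 0 <= x <= 1 by move=> [y _ <-]; exact: luk01.
have T0 : T 0 by exists mv0.
have TN x : T x -> T (1 - x) by move=> [y Sy <-]; exists (mvneg y) => //; exact: SN.
have TD x y : T x -> T y -> T (Num.min (x + y) 1).
  by move=> [u Su <-] [v Sv <-]; exists (mvadd u v) => //; exact: SD.
have T1 : T 1 by rewrite -[1]subr0; exact: TN.
have TB x y : T x -> T y -> y <= x -> T (x - y).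
  move=> Tx Ty yx; have := TN _ (TD _ _ (TN _ Tx) Ty).
  by rewrite min_l; [congr T; lra|lra].
have finT : finite_set T by exact: finite_image.
have finP : finite_set (T `&` [set x | 0 < x]) by exact: finite_setIl.
have memP x : (x \in fset_set (T `&` [set x | 0 < x])) = (x \in T `&` [set x | 0 < x]).
  exact: in_fset_set.
have [|d] := @seq_min (fset_set (T `&` [set x | 0 < x])).
  have : 1 \in enum_fset (fset_set (T `&` [set x | 0 < x])).
    by rewrite [_ \in _]memP inE; split => //=; exact: ltr01.
  by case: (enum_fset _).
rewrite memP inE => -[Td /= d0] dmin.
have {}dmin x : T x -> 0 < x -> d <= x.
  by move=> Tx x0; apply: dmin; rewrite memP inE.
have mult x : T x -> exists k : nat, x = k%:R * d.
  move=> Tx; pose k := Num.truncn (x / d); exists k.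
  have xd0 : 0 <= x / d by apply: divr_ge0; [have := T01 _ Tx; lra|exact: ltW].
  have /andP[kx xk] := truncn_itv xd0.
  have {}kx : k%:R * d <= x by rewrite -ler_pdivlMr.
  have {}xk : x < k.+1%:R * d by rewrite -ltr_pdivrMr.
  have Tr : T (x - k%:R * d).
    have : (k <= k)%N by []; move: {1 3}k; elim=> [|j IH] jk; first by rewrite mul0r subr0.
    have -> : x - j.+1%:R * d = x - j%:R * d - d by rewrite -natr1; lra.
    apply: TB => //; first by apply: IH; exact: ltnW.
    suff : j.+1%:R * d <= k%:R * d by rewrite -natr1; lra.
    by rewrite ler_pM2r// ler_nat.
  apply/eqP; rewrite -subr_eq0; apply/negPn/negP => neq0.
  have : d <= x - k%:R * d by apply: dmin => //; rewrite lt_def neq0 subr_ge0.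
  by move: xk; rewrite -natr1; lra.
have [m m1] := mult _ T1.
have m0 : (0 < m)%N by case: m m1 => // /eqP; rewrite mul0r oner_eq0.
have m0R : (0 < m%:R :> R) by rewrite ltr0n.
have dE : d = m%:R^-1.
  by apply: (mulfI (lt0r_neq0 m0R)); rewrite -m1 divff// lt0r_neq0.
exists m => //; apply/seteqP; split => [x Tx|_ [k /= km <-]].
  have [k xk] := mult _ Tx; exists k; last by rewrite xk dE.
  rewrite /= ltnS -(ler_nat R) -(ler_pM2r d0) -xk -m1.
  by have /andP[] := T01 _ Tx.
rewrite -dE; elim: k km => [|k IH] km; first by rewrite mul0r.
have kE : k%:R * d + d = k.+1%:R * d by rewrite -natr1 mulrDl mul1r.
have := TD _ _ (IH (ltnW km)) Td; rewrite kE min_l//.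
by rewrite [leRHS]m1 ler_pM2r// ler_nat.
Qed.

Let fin_subalg_card (S : set I) m : finite_set S -> (0 < m)%N ->
  val @` S = [set k%:R / m%:R | k in `I_m.+1] -> (#|` fset_set S|.-1 = m)%N.
Proof.
move=> finS m0 /(congr1 (fun T => #|` fset_set T|)).
rewrite !fset_set_image//.
rewrite !card_imfset//=; last first.
- exact: val_inj.
- move=> i j /(mulIf _) => /(_ _)/eqP; rewrite eqr_nat => ij; apply/eqP/ij.
  by rewrite invr_neq0// pnatr_eq0 -lt0n.
move=> ->; rewrite fset_set_II card_imfset//=; last exact: val_inj.
by rewrite size_enum_ord.
Qed.

Lemma fin_subalg_gt0 (S : set I) : finite_set S -> mv_closed S ->
  (0 < #|` fset_set S|.-1)%N.
Proof. by move=> fS /(fin_subalg fS)[m m0 /(fin_subalg_card fS m0)->]. Qed.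

Lemma fin_subalg_dvd (S T : set I) : finite_set T -> S `<=` T ->
  mv_closed S -> mv_closed T ->
  (#|` fset_set S|.-1 %| #|` fset_set T|.-1)%N.
Proof.
move=> fT ST Sc Tc; have fS := sub_finite_set ST fT.
have [m m0 SE] := fin_subalg fS Sc; have [n n0 TE] := fin_subalg fT Tc.
rewrite (fin_subalg_card fS m0 SE) (fin_subalg_card fT n0 TE).
have : (val @` S) (1%:R / m%:R) by rewrite SE; exists 1%N.
move=> /(@image_subset _ _ val _ _ ST); rewrite TE => -[k /= _ /eqP].
rewrite eqr_div ?pnatr_eq0 -?lt0n// -!natrM eqr_nat mul1n => /eqP <-.
exact: dvdn_mull.
Qed.

End FiniteSubalgebra.

Section FunctorH.
Variable R : realType.

Lemma char_range_closed A (chi : compact_char R A) :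
  [/\ range chi mv0, forall x, range chi x -> range chi (mvneg x) &
    forall x y, range chi x -> range chi y -> range chi (mvadd x y)].
Proof.
split; first by exists mv0; rewrite ?mv_hom0.
- by move=> _ [a _ <-]; exists (mvneg a); rewrite ?mv_homN.
- by move=> _ _ [a _ <-] [b _ <-]; exists (mvadd a b); rewrite ?mv_homD.
Qed.

Lemma char_mult_neq0 A (chi : compact_char R A) :
  (if `[< finite_set (range chi) >] then Some #|` fset_set (range chi)|.-1
   else None) != Some 0%N.
Proof.
case: asboolP => // /fin_subalg_gt0/(_ (char_range_closed chi)).
by rewrite lt0n; apply: contra_neq => -[].
Qed.

Definition char_mult A (chi : compact_char R A) : natbar :=
  NatBar (char_mult_neq0 chi).

Definition H_obj (A : chmvType) : ext_multiset := ExtMultiset (@char_mult A).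

Section Map.
Variables (B A : chmvType) (psi : chmv_hom B A).

Let H_compact (chi : compact_char R A) :
  compact [set b | mv_comp chi psi b = mv0].
Proof.
apply: (@subclosed_compact _ _ [set: B]) => //; last exact: chmv_compact.
have -> : [set b | mv_comp chi psi b = mv0] = psi @^-1` [set a | chi a = mv0].
  by [].
apply: closed_comp; first by move=> b _; exact: chmv_cont.
apply: compact_closed; [exact: chmv_hausdorff|exact: char_compact].
Qed.

Definition H_fun (chi : compact_char R A) : compact_char R B :=
  @CompactChar R B (mv_comp chi psi) (@H_compact chi).

Let H_fun_dvd (chi : H_obj A) : fin_dvd (mult (H_fun chi : H_obj B)) (mult chi).
Proof.
move=> n /=; case: asboolP => // fchi [<-].
have sub : range (H_fun chi) `<=` range chi by move=> _ [b _ <-]; exists (psi b).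
case: asboolP => [_|]; last by move=> /(_ (sub_finite_set sub fchi)).
exists #|` fset_set (range (H_fun chi))|.-1 => //.
by apply: fin_subalg_dvd => //; exact: char_range_closed.
Qed.

Definition H_map : em_hom (H_obj A) (H_obj B) := EMHom H_fun_dvd.

End Map.

Let H_map1 A : H_map (chmv_id A) = em_id (H_obj A).
Proof. by apply: em_hom_eq => chi; exact: compact_char_eq. Qed.

Let H_mapM A B C (g : chmv_hom C B) (f : chmv_hom B A) :
  H_map (chmv_comp f g) = em_comp (H_map g) (H_map f).
Proof. by apply: em_hom_eq => chi; exact: compact_char_eq. Qed.

Definition H_functor : functor (opposite CHMVcat) EMcat :=
  @Functor (opposite CHMVcat) EMcat H_obj (fun A B => @H_map B A) H_map1 H_mapM.

End FunctorH.

Section Eta.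
Variables (R : realType) (X : ext_multiset) (x : X).

Lemma fin_dvd_infty (m : natbar) : fin_dvd m natbar_infty.
Proof. by []. Qed.

Definition eval_fun (f : luk_prod R X) : unitI R :=
  luk_incl (@fin_dvd_infty (mult x)) (f x).

Let eval_fun0 : eval_fun mv0 = mv0.
Proof. exact: val_inj. Qed.

Let eval_funN : {morph eval_fun : f / mvneg f}.
Proof. by move=> f; exact: val_inj. Qed.

Let eval_funD : {morph eval_fun : f g / mvadd f g}.
Proof. by move=> f g; exact: val_inj. Qed.

Definition eval_hom : mv_hom (luk_prod R X) (unitI R) :=
  MVHom eval_fun0 eval_funN eval_funD.

Let eval_compact : compact [set f | eval_hom f = mv0].
Proof.
apply: (@subclosed_compact _ _ [set: luk_prod R X]) => //;
  last exact: chmv_compact.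
apply: (@closed_comp _ _ eval_hom [set mv0]).
  move=> f _; apply: (@cvg_comp _ _ _ (fun g : luk_prod R X => g x)
    (luk_incl (@fin_dvd_infty (mult x)))); last exact: luk_incl_continuous.
  exact: luk_prod_eval_continuous.
apply: compact_closed; [exact: chmv_hausdorff|exact: compact_set1].
Qed.

Definition eta : compact_char R (luk_prod R X) := @CompactChar R (luk_prod R X) eval_hom eval_compact.

End Eta.

Arguments eta R X x : clear implicits.

(* Main.v *)
(* Let K be the kernel of chi, and let atom x be the indicator of x. Each atom is
   idempotent, so chi sends it to 0 or 1. If chi killed every atom, K would contain
   all finite joins of atoms, hence their limit 1, by compactness. So chi sends some
   atom x to 1, and then chi f depends on f x only. A homomorphism from a chain of
   [0, 1] to [0, 1] is the inclusion: it commutes with doubling modulo 1, so any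
   discrepancy would grow exponentially under iterated doubling. Hence chi is
   evaluation at x. *)
Require Import Defs.
From mathcomp Require Import all_boot all_order all_algebra.
From mathcomp Require Import all_classical all_reals all_analysis.
From mathcomp Require Import finmap lra.

Import Order.TTheory GRing.Theory Num.Theory.

Local Open Scope classical_set_scope.
Local Open Scope ring_scope.

Lemma luk_val0 (R : realType) (s : natbar) : val (mv0 : luk R s) = 0.
Proof. by []. Qed.

Lemma luk_valN (R : realType) (s : natbar) (a : luk R s) :
  val (mvneg a) = 1 - val a.
Proof. by []. Qed.

Lemma luk_valD (R : realType) (s : natbar) (a b : luk R s) :
  val (mvadd a b) = Num.min (val a + val b) 1.
Proof. by []. Qed.

(** * Characters of a product of chains *)

Section Characters.
Variables (R : realType) (X : ext_multiset).
Local Notation A := (luk_prod R X).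

Lemma prod_negE (f : A) (x : X) : mvneg f x = mvneg (f x).
Proof. by []. Qed.

Lemma prod_addE (f g : A) (x : X) : mvadd f g x = mvadd (f x) (g x).
Proof. by []. Qed.

Definition atom (x : X) : A := fun y => if `[< y = x >] then mvneg mv0 else mv0.

Lemma atom_idem x : mvadd (atom x) (atom x) = atom x.
Proof.
apply: functional_extensionality_dep => y; rewrite prod_addE /atom.
by case: asboolP => _; rewrite ?mvadd1 ?mvadd0.
Qed.

(** Away from [x] the coatom is 1 and absorbs everything; at [x] both summands are 0. Hence a
    character that kills the coatom kills every [g] vanishing at [x]. *)
Lemma absorb_coatom x (g : A) :
  g x = mv0 -> mvadd g (mvneg (atom x)) = mvneg (atom x).
Proof.
move=> gx0; apply: functional_extensionality_dep => y; rewrite prod_addE !prod_negE /atom.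
case: asboolP => [->|_]; last by rewrite mvadd1.
by rewrite gx0 mvaddC mvadd0.
Qed.

Lemma closed_eval_eq (x : X) (a : luk R (mult x)) : closed [set f : A | f x = a].
Proof.
apply: (@closed_comp _ _ (fun f : A => f x) [set a]).
  by move=> f _; exact: luk_prod_eval_continuous.
apply: compact_closed; [exact: chmv_hausdorff|exact: compact_set1].
Qed.

Variable chi : mv_hom A (unitI R).

Lemma char_one : chi (mvneg mv0) <> mv0.
Proof.
rewrite mv_homN mv_hom0 => /(congr1 val); rewrite luk_valN luk_val0; lra.
Qed.

Lemma char_atom x : chi (atom x) = mv0 \/ chi (mvneg (atom x)) = mv0.
Proof.
have /(congr1 val) := congr1 chi (atom_idem x).
rewrite mv_homN mv_homD luk_valD; have := luk01 (chi (atom x)).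
case: (leP (val (chi (atom x)) + val (chi (atom x))) 1) => _ c01 cE.
  by left; apply: val_inj; rewrite luk_val0; lra.
by right; apply: val_inj; rewrite luk_valN luk_val0; lra.
Qed.

Lemma char_atom_support : compact [set f | chi f = mv0] ->
  exists x, chi (mvneg (atom x)) = mv0.
Proof.
move=> Kcompact; apply: contrapT => /forallNP noatom.
have atom0 x : chi (atom x) = mv0 by case: (char_atom x) => // /noatom.
pose K := [set f : A | chi f = mv0].
(* Elements of the kernel equal to 1 on a finite list: a filter base whose cluster points are 1
   everywhere. [{classic X}] supplies the decidable equality behind list membership. *)
pose B (s : seq {classic X}) := K `&` [set f | forall x, x \in s -> f x = mvneg mv0].
have BF : ProperFilter (filter_from setT B).
  apply: filter_from_proper.
    apply: filter_from_filter; first by exists [::].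
    move=> s t _ _; exists (s ++ t) => // f [Kf f1].
    by split; split => // x xs; apply: f1; rewrite mem_cat xs ?orbT.
  (* The sum of the atoms listed in [s] lies in [K] because [chi] kills each of them. *)
  move=> s _; exists (foldr (fun x f => mvadd (atom x) f) mv0 s); split.
    rewrite /K /=; elim: s => [|x s IH] /=; first by rewrite mv_hom0.
    by rewrite mv_homD IH mvadd0.
  move=> x; elim: s => [//|y s IH] /=; rewrite inE prod_addE /atom.
  move=> /predU1P[<-|/IH ->]; last by rewrite mvadd1.
  by rewrite asboolT// mvaddC mvadd1.
have [|p [Kp clp]] := Kcompact _ BF; first by exists [::] => // f [].
apply: char_one; rewrite -[RHS]Kp; congr (chi _).
apply/esym/functional_extensionality_dep => x.
(* The condition of being 1 at [x] is closed and holds on [B [:: x]], so it passes to the cluster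
   point. *)
apply: (@closed_eval_eq x (mvneg mv0)) => N Np; apply: clp => //.
by exists [:: (x : {classic X})] => // f [_]; apply; rewrite inE.
Qed.

Section Support.
Variable x : X.
Hypothesis chi_x : chi (mvneg (atom x)) = mv0.

Lemma char_eval0 (g : A) : g x = mv0 -> chi g = mv0.
Proof.
move=> /absorb_coatom/(congr1 (fun f => chi f)).
by rewrite mv_homD chi_x mvadd0.
Qed.

(** Induction on [n] for all [f] at once. If [f x] is at most 1/2, doubling [f] doubles the
    discrepancy; otherwise [mvneg f] has the same discrepancy and falls under the first case. *)
Lemma char_eval_dist n (f : A) :
  2 ^+ n * `|val (chi f) - val (f x)| <= 1.
Proof.
elim: n f => [|n IH] f.
  rewrite expr0 mul1r ler_norml.
  by have := luk01 (chi f); have := luk01 (f x); lra.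
have half (g : A) : val (g x) <= 2^-1 -> 2 ^+ n.+1 * `|val (chi g) - val (g x)| <= 1.
  move=> gx; have gxE : val (mvadd g g x) = 2 * val (g x).
    by rewrite prod_addE luk_valD min_l; lra.
  (* This element is max(2g - 1, 0), which vanishes at [x]. That [chi] kills it says [chi g] is at
     most 1/2, so doubling [chi g] involves no truncation. *)
  have chig0 : chi (mvneg (mvadd (mvneg g) (mvneg g))) = mv0.
    apply: char_eval0; apply: val_inj; rewrite prod_negE prod_addE prod_negE.
    by rewrite luk_valN luk_valD luk_valN luk_val0 min_r; lra.
  have chig : val (chi g) <= 2^-1.
    move: chig0; rewrite mv_homN mv_homD mv_homN => /(congr1 val).
    rewrite luk_valN luk_valD luk_valN luk_val0.
    by case: (leP (1 - _ + _) 1); lra.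
  have := IH (mvadd g g); rewrite gxE mv_homD luk_valD min_l; last lra.
  rewrite (_ : _ - _ = 2 * (val (chi g) - val (g x))); last lra.
  by rewrite normrM ger0_norm// mulrA -exprSr.
have [/half//|fx] := leP (val (f x)) 2^-1.
have := half (mvneg f); rewrite mv_homN prod_negE !luk_valN => H.
have /H : 1 - val (f x) <= 2^-1 by lra.
by rewrite distrC (_ : 1 - _ - _ = val (chi f) - val (f x)); last lra.
Qed.

Lemma char_eval (f : A) : val (chi f) = val (f x).
Proof.
apply/eqP; rewrite -subr_eq0 -normr_eq0; apply/negPn/negP => neq0.
set d := `|_| in neq0.
have d_gt0 : 0 < d by rewrite lt_def neq0 normr_ge0.
(* Since [n < 2 ^ n], an exponent above [d^-1] already breaks the bound [2 ^+ n * d <= 1]. *)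
have : d^-1 < 2 ^+ (Num.truncn d^-1).+1.
  apply: lt_le_trans (truncnS_gt _) _.
  by rewrite -natrX ler_nat ltnW// ltn_expl.
rewrite -[_ < _](ltr_pM2r d_gt0) mulVf// ltNge.
by rewrite char_eval_dist.
Qed.

End Support.

End Characters.

(** * Cardinalities of the chains *)

Lemma infinite_unit_interval (R : realType) : infinite_set `[0, 1 : R].
Proof.
move=> fin; apply: infinite_nat.
have <- : (fun n => n.+1%:R^-1 : R) @^-1` `[0, 1] = setT.
  apply/seteqP; split => // n _ /=.
  by rewrite in_itv/= invr_ge0 ler0n/= invf_le1// ler1n.
apply: finite_preimage => // m n _ _ /invr_inj/eqP.
by rewrite eqr_nat eqSS => /eqP.
Qed.

Lemma luk_set_finE (R : realType) (s : natbar) (n : nat) :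
  s = Some n :> option nat ->
  luk_set R s = [set k%:R / n%:R | k in `I_n.+1].
Proof.
move=> sn; have n0 : (0 < n%:R :> R).
  by rewrite ltr0n lt0n; apply: contraNneq (natbar_neq0 s) => <-; rewrite sn.
rewrite /luk_set [natbar_val s]sn; apply/seteqP; split => x /=.
  rewrite in_itv/= => -[/andP[x0 x1] [z _ zx]]; move: x0 x1.
  rewrite -zx pmulr_lge0 ?invr_gt0// ler_pdivrMr// mul1r ler0z.
  case: z {zx} => [k|//] _; rewrite -pmulrn ler_nat => kn.
  by exists k.
case=> k /= kn <-; split; last by exists k%:Z.
by rewrite in_itv/= divr_ge0//= ler_pdivrMr// mul1r ler_nat.
Qed.

(** The [n.+1] fractions are distinct and [val] is injective; the predecessor matches the shift by
    one in [char_mult]. *)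
Lemma unit_multiples_card (R : realType) (S : set (unitI R)) (n : nat) :
  (0 < n)%N -> val @` S = [set k%:R / n%:R | k in `I_n.+1] ->
  finite_set S /\ #|` fset_set S|.-1 = n.
Proof.
move=> n_gt0 SE; have finI : finite_set `I_n.+1 by exact: finite_II.
have finS : finite_set S.
  apply: sub_finite_set (@preimage_image _ _ val S) _.
  apply: finite_preimage => [a b _ _|]; first exact: val_inj.
  by rewrite SE; exact: finite_image.
split=> //; move: SE => /(congr1 (fun T => #|` fset_set T|)).
rewrite !fset_set_image// card_imfset/=; last exact: val_inj.
move=> ->; rewrite card_imfset/=.
  by rewrite fset_set_II card_imfset/= ?size_enum_ord//; exact: val_inj.
move=> k l /mulIf => /(_ _)/eqP; rewrite eqr_nat => kl; apply/eqP/kl.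
by rewrite invr_neq0// pnatr_eq0 -lt0n.
Qed.

(** * Bijectivity of [eta] and equality of multiplicities *)

Section EtaIso.
Variables (R : realType) (X : ext_multiset).
Local Notation A := (luk_prod R X).

Lemma eta_range (x : X) : val @` range (eta R X x) = luk_set R (mult x).
Proof.
apply/seteqP; split => [_ [_ [f _ <-] <-]|a la].
  exact: set_mem (valP (f x)).
(* The value [a] is attained at the element that is [a] at [x] and 0 elsewhere. *)
exists (eta R X x (@dfwith {classic X} _ (mv0 : A) x (exist _ a (mem_set la)))).
  by eexists.
by rewrite /= dfwithin.
Qed.

Lemma char_mult_eta (x : X) : char_mult (eta R X x) = mult x.
Proof.
apply: val_inj => /=; have rE := eta_range x.
case sE : (natbar_val (mult x)) => [n|].
  have n_gt0 : (0 < n)%N.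
    by rewrite lt0n; apply: contraNneq (natbar_neq0 (mult x)) => <-; rewrite sE.
  rewrite (luk_set_finE R _ _ sE) in rE.
  by have [fin ->] := unit_multiples_card _ _ _ n_gt0 rE; rewrite asboolT.
case: asboolP => // fin.
have := infinite_unit_interval R; rewrite (_ : `[0, 1]%classic = luk_set R (mult x)).
  by rewrite -rE => /(_ (finite_image _ fin)).
by rewrite /luk_set sE.
Qed.

(** The atom of [x] separates points: it is 1 at [x] and 0 at any other point. *)
Lemma eta_inj : injective (eta R X).
Proof.
move=> x y /(congr1 (fun c : compact_char R A => val (c (atom _ _ x)))).
rewrite /= /atom asboolT//; case: asboolP => [->//|_].
by rewrite -!/(val _) luk_valN luk_val0 subr0 => /eqP; rewrite oner_eq0.
Qed.

Lemma eta_surj (chi : compact_char R A) : exists x, eta R X x = chi.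
Proof.
have [x chi_x] := char_atom_support _ _ _ (@char_compact _ _ chi).
exists x; apply: compact_char_eq => f; apply: val_inj.
by rewrite (char_eval _ _ _ _ chi_x).
Qed.

Lemma eta_dvd (x : X) : fin_dvd (char_mult (eta R X x)) (mult x).
Proof. by rewrite char_mult_eta; exact: fin_dvd_refl. Qed.

Definition eta_hom : em_hom X (H_obj R A) := @EMHom X (H_obj R A) (eta R X) eta_dvd.

Lemma eta_hom_iso : is_isomorphism (C := EMcat) eta_hom.
Proof.
pose inv chi := projT1 (cid (eta_surj chi)).
have invK chi : eta R X (inv chi) = chi by rewrite /inv; case: cid.
(* A bijective morphism need not be invertible in this category; here multiplicities are preserved
   exactly, so the inverse also satisfies the divisibility condition. *)
have inv_dvd (chi : H_obj R A) : fin_dvd (mult (inv chi)) (mult chi).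
  by rewrite /= -[chi in X in fin_dvd _ X]invK char_mult_eta; exact: fin_dvd_refl.
exists (@EMHom (H_obj R A) X inv inv_dvd); split; apply: em_hom_eq => y /=.
  by apply: eta_inj; rewrite invK.
exact: invK.
Qed.

End EtaIso.

(** * Naturality of [eta] *)

Section Naturality.
Variables (R : realType) (X Y : ext_multiset) (phi : em_hom X Y).

(** Both sides send [f] to the real number underlying [f (phi x)]; only the membership proofs
    differ. *)
Lemma eta_F_map (x : X) :
  mv_comp (eta R X x) (F_map R phi) = eta R Y (phi x).
Proof. by apply: mv_hom_eq => f; exact: val_inj. Qed.

Lemma H_map_eta (x : X) :
  H_map R (F_map R phi) (eta R X x) = eta R Y (phi x).
Proof. by apply: compact_char_eq => f; rewrite -eta_F_map. Qed.

End Naturality.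

Section EtaTrans.
Variable R : realType.

Lemma eta_natural (X Y : ext_multiset) (phi : em_hom X Y) :
  em_comp (H_map R (F_map R phi)) (eta_hom R X) = em_comp (eta_hom R Y) phi.
Proof. by apply: em_hom_eq => x; exact: H_map_eta. Qed.

Definition eta_trans : nat_trans (functor_id EMcat)
    (functor_comp (H_functor R) (F_functor R)) :=
  @NatTrans _ _ (functor_id EMcat) (functor_comp (H_functor R) (F_functor R))
    (eta_hom R) eta_natural.

End EtaTrans.

Theorem theorem3p4 (R : realType) :
  (exists2 alpha : nat_trans (functor_id EMcat)
                     (functor_comp (H_functor R) (F_functor R)),
      is_natural_equivalence alpha &
      forall (X : ext_multiset) (x : X), em_fun (alpha X) x = eta R X x)
  /\
  (forall (X Y : ext_multiset) (phi : em_hom X Y) (x : X),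
      H_map R (F_map R phi) (eta R X x) = eta R Y (phi x)
      /\ mv_comp (eta R X x) (F_map R phi) = eta R Y (phi x)).
Proof.
split; last by move=> X Y phi x; split; [exact: H_map_eta|exact: eta_F_map].
exists (eta_trans R) => //.
by move=> X; exact: eta_hom_iso.
Qed.
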